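(* Let $n\ge 2$ and $p>2$, put $q=p/(p-1)<2$, and let $X$ be uniformly distributed on $B_p^n$. Let $$a=e_1,\qquad b=\frac{e_1+e_2}{\sqrt2}.$$ Then $(a_1^2,\ldots,a_n^2)\succ(b_1^2,\ldots,b_n^2)$, but $$\sup_{x\in B_p^n}|\langle a,x\rangle|=1,\qquad \sup_{x\in B_p^n}|\langle b,x\rangle|=\|b\|_q=2^{1/q-1/2}>1,$$ and hence $$\mathbb{E}\bigl(\langle b,X\rangle^2-1\bigr)_+>0,\qquad \mathbb{E}\bigl(\langle a,X\rangle^2-1\bigr)_+=0 .$$ In particular, $\langle b,X\rangle^2\preceq_{\mathrm{cx}}\langle a,X\rangle^2$ does not hold.
   Context: $B_p^n=\{x\in\mathbb{R}^n:\sum_{i=1}^n|x_i|^p\le 1\}$; $e_1,e_2$ are the first two standard basis vectors of $\mathbb{R}^n$; $\|b\|_q=(\sum_i|b_i|^q)^{1/q}$; $u_+=\max\{u,0\}$; $\langle\cdot,\cdot\rangle$ is the standard inner product. Majorization: for $u,v\in\mathbb{R}^n$ with the same coordinate sum, $u\succ v$ means $\sum_{i=1}^k u_i^\downarrow\ge\sum_{i=1}^k v_i^\downarrow$ for all $1\le k<n$, where $u^\downarrow$ is the rearrangement of the coordinates of $u$ in nonincreasing order. Convex order: for integrable real random variables $U,V$, $U\preceq_{\mathrm{cx}}V$ means $\mathbb{E}\Phi(U)\le\mathbb{E}\Phi(V)$ for every convex function $\Phi$ for which the expectations exist. *)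

(* Defs.v *)
From HB Require Import structures.
From mathcomp Require Import all_boot all_order all_algebra.
From mathcomp Require Import all_classical all_reals all_analysis.

Set Implicit Arguments.
Unset Strict Implicit.
Unset Printing Implicit Defensive.

Import Order.TTheory GRing.Theory Num.Theory.
Import numFieldNormedType.Exports.

Local Open Scope classical_set_scope.
Local Open Scope ring_scope.

Definition measure_rV_display : measure_display -> measure_display.
Proof. exact. Qed.

(* The product sigma-algebra on row vectors, i.e. the smallest one making every
   coordinate measurable; for T := R it is the Borel sigma-algebra of R^n. *)
Section measurable_rV.
Context {d} {T : measurableType d}.
Variable n : nat.

Let coors : 'I_n -> 'rV[T]_n -> T := fun i x => x 0 i.

Let rV_set0 : g_sigma_preimage coors set0.
Proof. exact: sigma_algebra0. Qed.

Let rV_setC A : g_sigma_preimage coors A -> g_sigma_preimage coors (~` A).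
Proof. exact: sigma_algebraC. Qed.

Let rV_bigcup (F : (set 'rV[T]_n)^nat) :
  (forall i, g_sigma_preimage coors (F i)) ->
  g_sigma_preimage coors (\bigcup_i (F i)).
Proof. exact: sigma_algebra_bigcup. Qed.

HB.instance Definition _ := @isMeasurable.Build (measure_rV_display d)
  'rV[T]_n (g_sigma_preimage coors) rV_set0 rV_setC rV_bigcup.

Lemma measurable_coord (i : 'I_n) :
  measurable_fun [set: 'rV[T]_n] (fun x : 'rV[T]_n => x 0 i).
Proof.
move=> _ Y mY; rewrite setTI; apply: sub_sigma_algebra => /=.
rewrite -bigcup_seq/=; exists i => /=; first by rewrite mem_index_enum.
by exists Y => //; rewrite setTI.
Qed.

Lemma measurable_fun_rV d' (T' : measurableType d') (f : T' -> 'rV[T]_n) :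
  (forall i, measurable_fun [set: T'] (fun x => f x 0 i)) ->
  measurable_fun [set: T'] f.
Proof.
move=> mf _ A mA; rewrite setTI.
have : preimage_set_system [set: T'] f (g_sigma_preimage coors)
    (f @^-1` A) by exists A => //; rewrite setTI.
rewrite -g_sigma_preimage_comp; apply: smallest_sub.
  exact: sigma_algebra_measurable.
rewrite -bigcup_seq/= => B [i _ [C mC <-]].
exact: mf.
Qed.

End measurable_rV.

Section lebesgue_rV.
Context {R : realType}.

Definition rV_cons n (xy : measurableTypeR R * 'rV[R]_n) : 'rV[R]_n.+1 :=
  row_mx xy.1%:M xy.2.

Definition rV_uncons n (x : 'rV[R]_n.+1) : measurableTypeR R * 'rV[R]_n :=
  (lsubmx (x : 'rV[R]_(1 + n)) 0 0, rsubmx (x : 'rV[R]_(1 + n))).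

Lemma rV_consK n : cancel (@rV_cons n) (@rV_uncons n).
Proof.
by move=> [x y]; rewrite /rV_uncons row_mxKl row_mxKr mxE eqxx.
Qed.

Lemma measurable_rV_cons n :
  measurable_fun [set: measurableTypeR R * 'rV[R]_n] (@rV_cons n).
Proof.
apply: measurable_fun_rV => i.
under eq_fun do rewrite /rV_cons mxE.
case: (fintype.split _) => j.
  by under eq_fun do rewrite mxE ord1 eqxx mulr1n; exact: measurable_fst.
exact: (measurableT_comp (measurable_coord j) measurable_snd).
Qed.

Lemma measurable_rV_uncons n :
  measurable_fun [set: 'rV[R]_n.+1] (@rV_uncons n).
Proof.
apply/measurable_fun_pairP; split.
  rewrite (_ : fst \o _ = (fun x : 'rV[R]_n.+1 => x 0 (lshift n (0 : 'I_1)))).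
    exact: measurable_coord.
  by apply/funext => x; rewrite /= mxE.
apply: measurable_fun_rV => i.
rewrite (_ : (fun _ => _) = (fun x : 'rV[R]_n.+1 => x 0 (rshift 1 i))).
  exact: measurable_coord.
by apply/funext => x; rewrite /= mxE.
Qed.

Section lebesgue_rV_cons.
Variables (n : nat) (mu : {sigma_finite_measure set 'rV[R]_n -> \bar R}).

Definition lebesgue_rV_cons : set 'rV[R]_n.+1 -> \bar R :=
  pushforward (lebesgue_measure \x mu)%E (@rV_cons n).

Let lebesgue_rV_cons0 : lebesgue_rV_cons set0 = 0%E.
Proof. by apply: measure0; exact: measurable_rV_cons. Qed.

Let lebesgue_rV_cons_ge0 A : (0 <= lebesgue_rV_cons A)%E.
Proof. by rewrite /lebesgue_rV_cons /pushforward. Qed.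

Let lebesgue_rV_cons_sigma_additive : semi_sigma_additive lebesgue_rV_cons.
Proof.
by apply: measure_semi_sigma_additive; exact: measurable_rV_cons.
Qed.

HB.instance Definition _ := isMeasure.Build _ _ _ lebesgue_rV_cons
  lebesgue_rV_cons0 lebesgue_rV_cons_ge0 lebesgue_rV_cons_sigma_additive.

Lemma lebesgue_rV_consE (A : set R) (B : set 'rV[R]_n) :
  measurable A -> measurable B ->
  lebesgue_rV_cons (@rV_uncons n @^-1` (A `*` B)) =
    (lebesgue_measure A * mu B)%E.
Proof.
move=> mA mB; rewrite /lebesgue_rV_cons /pushforward -comp_preimage.
rewrite (_ : _ \o _ = id) ?preimage_id; first exact: product_measure1E.
by apply/funext => x; exact: rV_consK.
Qed.

Let lebesgue_rV_cons_sigma_finite :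
  sigma_finite [set: 'rV[R]_n.+1] lebesgue_rV_cons.
Proof.
have /sigma_finiteP[F [FT ndF Foo]] := sigma_finiteT (@lebesgue_measure R).
have /sigma_finiteP[G [GT ndG Goo]] := sigma_finiteT mu.
exists (fun k => @rV_uncons n @^-1` (F k `*` G k)).
  rewrite -preimage_bigcup -[LHS](preimage_setT (@rV_uncons n)).
  congr (_ @^-1` _); apply/esym/seteqP; split => // -[x y] _.
  have [i _ Fix] : (\bigcup_i F i) x by rewrite -FT.
  have [j _ Gjy] : (\bigcup_i G i) y by rewrite -GT.
  exists (maxn i j) => //; split => /=.
  - by move: x Fix; exact/subsetPset/ndF/leq_maxl.
  - by move: y Gjy; exact/subsetPset/ndG/leq_maxr.
move=> k; have [mFk Fkoo] := Foo k; have [mGk Gkoo] := Goo k; split.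
  rewrite -[X in measurable X]setTI; apply: measurable_rV_uncons => //.
  exact: measurableX.
by rewrite lebesgue_rV_consE// lte_mul_pinfty// ge0_fin_numE.
Qed.

HB.instance Definition _ := Measure_isSigmaFinite.Build _ _ _ lebesgue_rV_cons
  lebesgue_rV_cons_sigma_finite.

End lebesgue_rV_cons.

(* n-dimensional Lebesgue measure: R^0 has mass 1, and on R^(n+1) it is the
   image under rV_cons of the product of the Lebesgue measures of R and R^n. *)
Fixpoint lebesgue_rV n : {sigma_finite_measure set 'rV[R]_n -> \bar R} :=
  match n with
  | 0 => \d_(0 : 'rV[R]_0)
  | m.+1 => lebesgue_rV_cons (lebesgue_rV m)
  end.

End lebesgue_rV.

(* The sigma-finite measure lebesgue_rV n is characterised by this formula. *)
Lemma lebesgue_rV_box (R : realType) n (A : 'I_n -> set R) :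
  (forall i, measurable (A i)) ->
  lebesgue_rV n [set x : 'rV[R]_n | forall i, A i (x 0 i)] =
    (\prod_(i < n) lebesgue_measure (A i))%E.
Proof.
elim: n A => [|n IHn] A mA.
  by rewrite big_ord0/= diracE mem_set//= => -[].
rewrite big_ord_recl -IHn// -lebesgue_rV_consE//; last first.
  rewrite [X in measurable X](_ : _ = \bigcap_(i in [set: 'I_n])
      ((fun x : 'rV[R]_n => x 0 i) @^-1` A (lift ord0 i))); last first.
    by apply/seteqP; split => x /= Ax i; [move=> _|]; exact: Ax.
  apply: fin_bigcap_measurable => // i _.
  by rewrite -[X in measurable X]setTI; exact: measurable_coord.
congr (lebesgue_rV_cons _ _); apply/seteqP; split => x /=.
  move=> Ax; split => [|i]; rewrite mxE.
    by rewrite (_ : lshift n 0 = ord0) //; exact: val_inj.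
  by rewrite (_ : rshift 1 i = lift ord0 i) //; exact: val_inj.
move=> [A0 A1] i; case: (unliftP ord0 i) => [j ->|->].
  move: (A1 j); rewrite mxE.
  by rewrite (_ : rshift 1 j = lift ord0 j) //; exact: val_inj.
move: A0; rewrite mxE.
by rewrite (_ : lshift n 0 = ord0) //; exact: val_inj.
Qed.

Section definitions.
Context {R : realType}.

Definition inner n (u v : 'rV[R]_n) : R := \sum_(i < n) u 0 i * v 0 i.

Definition lp_ball n (p : R) : set 'rV[R]_n :=
  [set x | \sum_(i < n) `|x 0 i| `^ p <= 1].

Definition lq_norm n (q : R) (u : 'rV[R]_n) : R :=
  (\sum_(i < n) `|u 0 i| `^ q) `^ q^-1.

Definition decreasing_rearrangement n (u : 'rV[R]_n) : seq R :=
  sort >=%R [seq u 0 i | i <- enum 'I_n].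

Definition majorizes n (u v : 'rV[R]_n) : Prop :=
  \sum_(i < n) u 0 i = \sum_(i < n) v 0 i /\
  forall k : nat, (1 <= k < n)%N ->
    \sum_(i < k) (decreasing_rearrangement v)`_i <=
      \sum_(i < k) (decreasing_rearrangement u)`_i.

Definition uniform_on d (T : measurableType d) (P : probability T R) n
    (X : {RV P >-> 'rV[R]_n}) (B : set 'rV[R]_n) : Prop :=
  forall A : set 'rV[R]_n, measurable A ->
    distribution P X A =
      (lebesgue_rV n (A `&` B) / lebesgue_rV n B)%E.

(* "The expectations exist" is read as: Phi(U) and Phi(V) are integrable. *)
Definition convex_order d d' (T : measurableType d) (T' : measurableType d')
    (P : probability T R) (Q : probability T' R)
    (U : T -> R) (V : T' -> R) : Prop :=
  forall Phi : R -> R, convex_function [set: R^o] Phi ->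
    P.-integrable setT (EFin \o (Phi \o U)) ->
    Q.-integrable setT (EFin \o (Phi \o V)) ->
    ('E_P[Phi \o U] <= 'E_Q[Phi \o V])%E.

End definitions.
Arguments lp_ball {R} n p.

(* Main.v *)
Require Import Defs.
From mathcomp Require Import all_boot all_order all_algebra.
From mathcomp Require Import all_classical all_reals all_analysis.
From mathcomp Require Import measurable_realfun lra.

Set Implicit Arguments.
Unset Strict Implicit.
Unset Printing Implicit Defensive.

Import Order.TTheory GRing.Theory Num.Theory.
Import numFieldNormedType.Exports.

Local Open Scope classical_set_scope.
Local Open Scope ring_scope.

(** The whole phenomenon comes from the linear functional [inner b], whose
    maximum over the ball exceeds 1 although [b], like [a], has Euclidean norm 1.

    Write [s] for the inverse square root of 2. By Hoelder's inequality two
    coordinates of a point of the ball have absolute values of sum at most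
    [2 `^ (1 - p^-1)], with equality when both are [2 `^ - p^-1] and the others
    vanish; hence the maximum of [|inner b|] is [s * 2 `^ q^-1]
    ([sup_inner_two_spike]), which is also the [q]-norm of [b]
    ([lq_norm_two_spike]). It exceeds 1 since [q^-1 = 1 - p^-1 > 2^-1]. The
    functional [inner a] is a coordinate, bounded by 1 on the ball.

    Since [X] lies in the ball almost surely ([uniform_on_compl]), the positive
    part of [inner a X ^+ 2 - 1] vanishes almost surely. For [b], exceeding 1 at
    one point must be turned into exceeding 1 with positive probability. The
    point [y] with two entries [s] satisfies [inner b y = 1] and, because
    [p > 2], lies in the interior of the ball; so the ball contains an open box
    with lowest vertex [y] ([lp_ball_upper_box]). This box has positive volume,
    and [inner b > 1] on it.

    Finally, [t |-> max (t - 1) 0] is convex, and its integrability follows from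
    the boundedness of the ball, so it refutes the convex order. Majorization
    holds because the squares of [a] are concentrated at one coordinate
    ([majorizes_concentrated]). *)

(** * Majorization, suprema and powers *)

(** A vector whose whole mass sits at one coordinate has its total as first
    partial sum; no partial sum of a nonnegative vector exceeds the total. *)
Lemma majorizes_concentrated (R : realType) n (u v : 'rV[R]_n) (i : 'I_n) :
  (forall k, 0 <= u 0 k) -> (forall k, 0 <= v 0 k) ->
  \sum_(k < n) u 0 k = \sum_(k < n) v 0 k ->
  u 0 i = \sum_(k < n) v 0 k -> majorizes u v.
Proof.
move=> u_ge0 v_ge0 uv ui; split=> // k /andP[k_gt0 k_lt].
have size_dr (w : 'rV[R]_n) : size (decreasing_rearrangement w) = n.
  by rewrite size_sort size_map size_enum_ord.
have sum_dr (w : 'rV[R]_n) :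
    \sum_(j < n) (decreasing_rearrangement w)`_j = \sum_(j < n) w 0 j.
  rewrite -(big_mkord xpredT (nth 0 (decreasing_rearrangement w))).
  rewrite -[X in index_iota _ X](size_dr w) -(big_nth 0 xpredT id).
  by rewrite (perm_big _ (permEl (perm_sort _ _))) big_map big_enum.
have dr_ge0 (w : 'rV[R]_n) j : (forall l, 0 <= w 0 l) ->
    0 <= (decreasing_rearrangement w)`_j.
  move=> w_ge0; have [jn|nj] := ltnP j n; last by rewrite nth_default ?size_dr.
  have : (decreasing_rearrangement w)`_j \in decreasing_rearrangement w.
    by rewrite mem_nth ?size_dr.
  by rewrite mem_sort => /mapP[l _ ->].
apply: (@le_trans _ _ (\sum_(j < n) v 0 j)).
  rewrite -sum_dr (big_ord_widen _ _ (ltnW k_lt)) big_mkcond /=.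
  by apply: ler_sum => j _; case: ifP => // _; exact: dr_ge0.
rewrite -{}ui; apply: (@le_trans _ _ (decreasing_rearrangement u)`_0).
  have ui_in : u 0 i \in decreasing_rearrangement u.
    by rewrite mem_sort map_f ?mem_enum.
  have : sorted >=%R (decreasing_rearrangement u).
    by apply: sort_sorted => x y; exact: le_total.
  case: (decreasing_rearrangement u) ui_in => // x s; rewrite inE.
  case/predU1P=> [->//|ui_in] xs.
  have /allP/(_ _ ui_in)// : all (>=%R x) s.
  by apply: order_path_min xs => y z t zy tz; exact: le_trans tz zy.
case: k k_gt0 {k_lt} => // k _.
by rewrite big_ord_recl lerDl sumr_ge0// => j _; exact: dr_ge0.
Qed.

Lemma sup_maximum (R : realType) (E : set R) (M : R) :
  E M -> ubound E M -> sup E = M.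
Proof.
move=> EM ubM; apply/eqP; rewrite eq_le ge_sup//; last by exists M.
by rewrite ub_le_sup//; exists M.
Qed.

Lemma gt1_ltr_powR (R : realType) (a : R) :
  1 < a -> {homo powR a : x y / x < y}.
Proof.
move=> a_gt1 x y xy; have a_gt0 : 0 < a by rewrite (lt_trans ltr01).
rewrite -(subrK x y) powRD; last by rewrite (gt_eqF a_gt0) implybT.
rewrite ltr_pMl ?powR_gt0//.
have yx_gt0 : 0 < y - x by rewrite subr_gt0.
have := gt0_ltr_powR yx_gt0 _ _ a_gt1.
by rewrite powR1; apply; rewrite nnegrE// ltW.
Qed.

(** * The functionals and the ball *)

Definition two_spike (R : realType) n (i j : 'I_n) (c : R) : 'rV[R]_n :=
  c *: (delta_mx 0 i + delta_mx 0 j).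

Lemma sum_two_spike (R : realType) n (i j : 'I_n) (c : R) (F : R -> R) :
  i != j -> F 0 = 0 -> \sum_(k < n) F (two_spike i j c 0 k) = F c + F c.
Proof.
move=> ij F0; rewrite (bigD1 i)//= (bigD1 j) 1?eq_sym//= big1 => [|k /andP[ki kj]].
  rewrite !mxE !eqxx /= (negbTE ij) eq_sym (negbTE ij).
  by rewrite addr0 add0r mulr1 addr0.
by rewrite !mxE /= (negbTE ki) (negbTE kj) addr0 mulr0.
Qed.

Lemma inner_delta (R : realType) n (i : 'I_n) (x : 'rV[R]_n) :
  inner (delta_mx 0 i) x = x 0 i.
Proof.
rewrite /inner (bigD1 i)//= big1 => [|k ki]; first by rewrite mxE !eqxx mul1r addr0.
by rewrite mxE (negbTE ki) mul0r.
Qed.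

Lemma inner_two_spike (R : realType) n (i j : 'I_n) (c : R) (x : 'rV[R]_n) :
  inner (two_spike i j c) x = c * (x 0 i + x 0 j).
Proof.
rewrite -(inner_delta i) -(inner_delta j) /inner -big_split mulr_sumr.
by apply: eq_bigr => k _; rewrite !mxE /= -mulrDl mulrA.
Qed.

Lemma lp_ball_coord_le1 (R : realType) n (p : R) (x : 'rV[R]_n) (i : 'I_n) :
  0 < p -> lp_ball n p x -> `|x 0 i| <= 1.
Proof.
move=> p_gt0; rewrite /lp_ball/= (bigD1 i)//= => x_le1.
rewrite leNgt; apply/negP => xi_gt1.
have : 1 < `|x 0 i| `^ p.
  by have := gt0_ltr_powR p_gt0 _ _ xi_gt1; rewrite powR1; apply; rewrite nnegrE.
apply/negP; rewrite -leNgt; apply: le_trans x_le1.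
by rewrite lerDl sumr_ge0// => k _; exact: powR_ge0.
Qed.

(** Hoelder's inequality against the vector with two entries equal to 1. *)
Lemma lp_ball_two_coords (R : realType) n (p : R) (x : 'rV[R]_n) (i j : 'I_n) :
  1 < p -> i != j -> lp_ball n p x ->
  `|x 0 i| + `|x 0 j| <= 2 `^ (1 - p^-1).
Proof.
move=> p_gt1 ij; rewrite /lp_ball/= (bigD1 i)//= (bigD1 j) 1?eq_sym//= => x_le1.
have p_gt0 : 0 < p by lra.
have q_gt0 : 0 < 1 - p^-1 by rewrite subr_gt0 invf_lt1.
have := @hoelder2 R `|x 0 i| `|x 0 j| 1 1 p (1 - p^-1)^-1.
rewrite invrK !mulr1 !powR1 => /(_ _ _ _ _ p_gt0).
rewrite invr_gt0 subrKC !normr_ge0 => /(_ isT isT ler01 ler01 q_gt0 erefl).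
move=> /le_trans; apply.
rewrite -[leRHS]mul1r ler_wpM2r ?powR_ge0//.
have -> : 1 = 1 `^ p^-1 :> R by rewrite powR1.
apply: ge0_ler_powR; rewrite ?nnegrE ?addr_ge0 ?powR_ge0 ?invr_ge0 ?(ltW p_gt0)//.
by apply: le_trans x_le1; rewrite addrA lerDl sumr_ge0.
Qed.

(** * Volume and the uniform distribution *)

Lemma measurable_lp_ball (R : realType) n (p : R) : measurable (lp_ball n p).
Proof.
rewrite /lp_ball -[X in measurable X]setTI; apply: measurable_fun_le => //.
apply: measurable_sum => i.
apply: (measurableT_comp (measurable_powR p)).
apply: (measurableT_comp (@normr_measurable R setT)).
exact: measurable_coord.
Qed.

Lemma measurable_inner (R : realType) n (u : 'rV[R]_n) :
  measurable_fun [set: 'rV[R]_n] (inner u).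
Proof.
apply: measurable_sum => i; apply: measurable_funM => //.
exact: measurable_coord.
Qed.

(** The deficit [1 - \sum_i y_i ^ p] is shared out among the coordinates
    [y_i ^ p], which yields a point [z] of the ball with [y_i < z_i] for all [i];
    the open box between [y] and [z] is then contained in the ball. *)
Lemma lp_ball_upper_box (R : realType) n (p : R) (y : 'rV[R]_n) :
  0 < p -> (forall i, 0 <= y 0 i) -> \sum_(i < n) y 0 i `^ p < 1 ->
  exists A : set 'rV[R]_n, [/\ measurable A, A `<=` lp_ball n p,
    (0 < lebesgue_rV n A)%E & forall x i, A x -> y 0 i < x 0 i].
Proof.
move=> p_gt0 y_ge0 y_lt1; set r := \sum_(i < n) _ in y_lt1.
(* dividing by [n.+1] instead of [n] includes [n = 0] *)
pose dlt := (1 - r) / n.+1%:R.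
have dlt_gt0 : 0 < dlt by rewrite divr_gt0// subr_gt0.
pose z i := (y 0 i `^ p + dlt) `^ p^-1.
have zp i : z i `^ p = y 0 i `^ p + dlt.
  rewrite -powRrM mulVf ?gt_eqF// powRr1//.
  by rewrite addr_ge0 ?powR_ge0// ltW.
have yz i : y 0 i < z i.
  rewrite ltNge; apply/negP => zy.
  have := ge0_ler_powR (ltW p_gt0) _ _ zy; rewrite zp !nnegrE.
  move=> /(_ (powR_ge0 _ _) (y_ge0 _)); apply/negP.
  by rewrite -ltNge ltrDl.
pose I i : set R := `]y 0 i, z i[%classic.
exists [set x : 'rV[R]_n | forall i, I i (x 0 i)]; split.
- rewrite [X in measurable X](_ : _ = \bigcap_(i in [set: 'I_n])
      ((fun x : 'rV[R]_n => x 0 i) @^-1` I i)); last first.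
    by apply/seteqP; split => x /= Ax i; [move=> _|]; exact: Ax.
  apply: fin_bigcap_measurable => // i _.
  rewrite -[X in measurable X]setTI; apply: measurable_coord => //.
  exact: measurable_itv.
- move=> x /= Ax; rewrite /lp_ball/=.
  have : \sum_(i < n) `|x 0 i| `^ p <= \sum_(i < n) (y 0 i `^ p + dlt).
    apply: ler_sum => i _; rewrite -zp.
    have := Ax i; rewrite /I/= in_itv/= => /andP[yx xz].
    have x_ge0 : 0 <= x 0 i by apply: le_trans (y_ge0 i) (ltW yx).
    apply: ge0_ler_powR; rewrite ?nnegrE ?powR_ge0 ?(ltW p_gt0)//.
    by rewrite ger0_norm// ltW.
  move=> /le_trans; apply; rewrite big_split/= -/r sumr_const card_ord.
  have : dlt *+ n <= 1 - r; last by lra.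
  have <- : dlt *+ n.+1 = 1 - r by rewrite -mulr_natr divfK ?pnatr_eq0.
  by rewrite mulrS lerDr ltW.
- rewrite lebesgue_rV_box => [|i]; last exact: measurable_itv.
  elim/big_ind: _ => // [a b|i _]; first exact: mule_gt0.
  by rewrite lebesgue_measure_itv/= lte_fin yz EFinN -EFinD lte_fin subr_gt0 yz.
- by move=> x i /= /(_ i); rewrite /I/= in_itv/= => /andP[].
Qed.

Section uniform.
Context (R : realType) (d : measure_display) (T : measurableType d).
Context (P : probability T R) (n : nat) (X : {RV P >-> 'rV[R]_n}).
Variable B : set 'rV[R]_n.
Hypotheses (mB : measurable B) (unifX : uniform_on X B).

Lemma uniform_on_preimageE (A : set 'rV[R]_n) : measurable A ->
  P (X @^-1` A) = (lebesgue_rV n (A `&` B) / lebesgue_rV n B)%E.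
Proof. exact: unifX. Qed.

Let measurable_preimage_compl : measurable (X @^-1` (~` B)).
Proof.
rewrite -[X in measurable X]setTI.
by apply: measurable_funPT => //; exact: measurableC.
Qed.

Lemma uniform_on_compl : P (X @^-1` (~` B)) = 0%E.
Proof.
by rewrite uniform_on_preimageE ?setICl ?measure0 ?mul0e//; exact: measurableC.
Qed.

(** The total mass 1 is the quotient of the volume of [B] by itself, and in the
    extended reals this quotient vanishes when the volume is infinite. *)
Lemma uniform_on_fin_volume : (lebesgue_rV n B != +oo)%E.
Proof.
have := uniform_on_preimageE (@measurableT _ _); rewrite setTI preimage_setT.
rewrite probability_setT; case: eqVneq => // ->.
by rewrite invey mule0 => /eqP; rewrite onee_eq0.
Qed.

Lemma uniform_on_gt0 (A : set 'rV[R]_n) : measurable A -> A `<=` B ->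
  (0 < lebesgue_rV n A)%E -> (0 < P (X @^-1` A))%E.
Proof.
move=> mA AB A_gt0; rewrite uniform_on_preimageE// setIidl//.
have B_gt0 : (0 < lebesgue_rV n B)%E.
  by apply: (lt_le_trans A_gt0); rewrite le_measure// inE.
by rewrite mule_gt0// inve_gt0 ?uniform_on_fin_volume// gt_eqF.
Qed.

(** Almost surely [X] lies in [B], where [f] is bounded. *)
Lemma uniform_on_integrable (f : 'rV[R]_n -> R) (M : R) :
  measurable_fun [set: 'rV[R]_n] f -> (forall x, B x -> `|f x| <= M) ->
  P.-integrable setT (fun w => (f (X w))%:E).
Proof.
move=> mf fM.
have mfX : measurable_fun [set: T] (EFin \o (f \o X)).
  by apply/measurable_EFinP; exact: measurableT_comp mf (measurable_funPT X).
apply/(negligible_integrable measurable_preimage_compl measurableT mfX uniform_on_compl).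
apply: (@le_integrable _ _ _ _ _ _ _ (EFin \o cst M)).
- by apply: measurableD.
- exact: measurable_funTS.
- move=> w [_ /= /contrapT Bw]; rewrite lee_fin.
  by rewrite (le_trans (fM _ Bw))// ler_norm.
- by apply: finite_measure_integrable_cst; apply: measurableD.
Qed.

Lemma uniform_on_expectation0 (f : 'rV[R]_n -> R) :
  measurable_fun [set: 'rV[R]_n] f -> (forall x, B x -> f x = 0) ->
  ('E_P[fun w => f (X w)] = 0)%E.
Proof.
move=> mf f0; rewrite unlock.
rewrite (ae_eq_integral (cst 0%E)) ?integral0//.
  by apply/measurable_EFinP; exact: measurableT_comp mf (measurable_funPT X).
exists (X @^-1` (~` B)); split; last 1 first.
- by move=> w /= fw Bw; apply: fw => _; rewrite f0.
- exact: measurable_preimage_compl.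
- exact: uniform_on_compl.
Qed.

End uniform.

(** A nonnegative variable with zero mean vanishes almost everywhere. *)
Lemma expectation_gt0 (R : realType) (d : measure_display)
    (T : measurableType d) (P : probability T R) (f : T -> R) (A : set T) :
  measurable_fun [set: T] f -> (forall w, 0 <= f w) -> measurable A ->
  (0 < P A)%E -> (forall w, A w -> 0 < f w) -> (0 < 'E_P[f])%E.
Proof.
move=> mf f_ge0 mA A_gt0 fA; rewrite lt_neqAle expectation_ge0// andbT.
apply/eqP => /esym; rewrite unlock => f0.
have /ae_eq_integral_abs : (\int[P]_w `|(f w)%:E| = 0)%E.
  by rewrite -[RHS]f0; apply: eq_integral => w _; rewrite gee0_abs// lee_fin.
move=> /(_ measurableT (proj2 (measurable_EFinP _ _) mf))[N [mN N0 fN]].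
have : (P A <= P N)%E.
  rewrite le_measure ?inE// => w Aw; apply: fN => /= /(_ I)[fw].
  by have := fA _ Aw; rewrite fw ltxx.
by rewrite N0 leNgt A_gt0.
Qed.

(** * Extremal values and the test function *)

Lemma sup_inner_delta (R : realType) n (p : R) (i : 'I_n) : 0 < p ->
  sup [set `|inner (delta_mx 0 i) x| | x in lp_ball n p] = 1.
Proof.
move=> p_gt0; apply: sup_maximum.
  exists (delta_mx 0 i); last by rewrite inner_delta mxE !eqxx normr1.
  rewrite /lp_ball/= (bigD1 i)//= big1 => [|k ki].
    by rewrite mxE !eqxx normr1 powR1 addr0.
  by rewrite mxE (negbTE ki) normr0 powR0// gt_eqF.
by move=> _ [x xB <-]; rewrite inner_delta; exact: lp_ball_coord_le1 xB.
Qed.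

Lemma sup_inner_two_spike (R : realType) n (p : R) (i j : 'I_n) (c : R) :
  1 < p -> i != j -> 0 <= c ->
  sup [set `|inner (two_spike i j c) x| | x in lp_ball n p]
    = c * 2 `^ (1 - p^-1).
Proof.
move=> p_gt1 ij c_ge0; have p_gt0 : 0 < p by lra.
apply: sup_maximum.
  (* the equality case of Hoelder's inequality *)
  exists (two_spike i j (2 `^ - p^-1)).
    rewrite /lp_ball/= (sum_two_spike (F := fun t => `|t| `^ p) _ ij); last first.
      by rewrite normr0 powR0// gt_eqF.
    rewrite ger0_norm ?powR_ge0// -powRrM mulNr mulVf ?gt_eqF// powRN.
    by rewrite powRr1//; lra.
  rewrite inner_two_spike !mxE !eqxx /= (negbTE ij) eq_sym (negbTE ij).
  rewrite addr0 add0r mulr1 powRB ?powRr1 ?pnatr_eq0 ?implybT// powRN.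
  rewrite ger0_norm; first by congr (c * _); lra.
  by rewrite mulr_ge0// addr_ge0// invr_ge0 powR_ge0.
move=> _ [x xB <-]; rewrite inner_two_spike normrM ger0_norm// ler_wpM2l//.
by rewrite (le_trans (ler_normD _ _))//; exact: lp_ball_two_coords.
Qed.

Lemma lq_norm_two_spike (R : realType) n (q : R) (i j : 'I_n) (c : R) :
  0 < q -> i != j -> 0 <= c -> lq_norm q (two_spike i j c) = c * 2 `^ q^-1.
Proof.
move=> q_gt0 ij c_ge0; rewrite /lq_norm.
rewrite (sum_two_spike (F := fun t => `|t| `^ q) _ ij); last first.
  by rewrite normr0 powR0// gt_eqF.
rewrite /= ger0_norm// -mulr2n -[c `^ q *+ 2]mulr_natr powRM ?powR_ge0//.
by rewrite -powRrM mulfV ?gt_eqF// powRr1.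
Qed.

Lemma convex_pos_part_sub1 (R : realType) :
  convex_function [set: R^o] (fun t : R => Num.max (t - 1) 0).
Proof.
pose g (v : R) := Num.max (v - 1) 0.
have gconv (u x y : R) : 0 <= u -> u <= 1 ->
    g (u * x + (1 - u) * y) <= u * g x + (1 - u) * g y.
  move=> u_ge0 u_le1; rewrite ge_max; apply/andP; split; last first.
    by apply: addr_ge0; apply: mulr_ge0; rewrite ?subr_ge0// le_max lexx orbT.
  apply: (@le_trans _ _ (u * (x - 1) + (1 - u) * (y - 1))); first by nra.
  by apply: lerD; apply: ler_wpM2l; rewrite ?subr_ge0// le_max lexx.
by move=> t x y _ _; rewrite !convRE; exact: gconv.
Qed.

(** * The counterexample *)

Theorem mainTheorem4 (R : realType) (n : nat) (hn : (2 <= n)%N)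
    (p : R) (hp : 2 < p)
    (d : measure_display) (T : measurableType d) (P : probability T R)
    (X : {RV P >-> 'rV[R]_n}) (hX : uniform_on X (lp_ball n p)) :
  let q := p / (p - 1) in
  let e1 : 'rV[R]_n := delta_mx 0 (Ordinal (ltnW hn)) in
  let e2 : 'rV[R]_n := delta_mx 0 (Ordinal hn) in
  let a := e1 in
  let b : 'rV[R]_n := (Num.sqrt 2)^-1 *: (e1 + e2) in
  q < 2 /\
  majorizes (\row_i (a 0 i ^+ 2)) (\row_i (b 0 i ^+ 2)) /\
  sup [set `|inner a x| | x in lp_ball n p] = 1 /\
  (sup [set `|inner b x| | x in lp_ball n p] = lq_norm q b /\
   lq_norm q b = 2 `^ (q^-1 - 2^-1) /\
   1 < 2 `^ (q^-1 - 2^-1)) /\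
  (0 < 'E_P[(fun w => Num.max (inner b (X w) ^+ 2 - 1) 0)%R])%E /\
  ('E_P[(fun w => Num.max (inner a (X w) ^+ 2 - 1) 0)%R] = 0)%E /\
  (P.-integrable setT (fun w => (inner a (X w) ^+ 2)%:E) /\
   P.-integrable setT (fun w => (inner b (X w) ^+ 2)%:E) /\
   ~ convex_order P P (fun w => inner b (X w) ^+ 2)
                      (fun w => inner a (X w) ^+ 2)).
Proof.
move=> q e1 e2 a b.
have p_gt0 : 0 < p by lra.
have p_gt1 : 1 < p by lra.
pose i := Ordinal (ltnW hn); pose j := Ordinal hn.
have ij : i != j by [].
have qV : q^-1 = 1 - p^-1 by rewrite /q invf_div mulrBl mulfV ?gt_eqF// mul1r.
have q_gt0 : 0 < q by rewrite divr_gt0// subr_gt0.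
have sqrt2_gt0 : 0 < Num.sqrt 2 :> R by rewrite sqrtr_gt0.
pose s : R := (Num.sqrt 2)^-1.
have s_gt0 : 0 < s by rewrite invr_gt0.
have s2 : s ^+ 2 = 2^-1 by rewrite exprVn sqr_sqrtr.
have sE : s = 2 `^ - 2^-1 by rewrite powRN powR12_sqrt.
have bE : b = two_spike i j s by [].
have half_gt_Vp : 2^-1 > p^-1 by rewrite ltf_pV2 ?posrE.
have s_normE : s * 2 `^ q^-1 = 2 `^ (q^-1 - 2^-1).
  by rewrite sE mulrC -powRD// pnatr_eq0 implybT.
have norm_gt1 : 1 < 2 `^ (q^-1 - 2^-1) :> R.
  rewrite -[ltLHS](powRr0 2); apply: gt1_ltr_powR; rewrite ?ltr1n// subr_gt0 qV; lra.
pose f u (x : 'rV[R]_n) := Num.max (inner u x ^+ 2 - 1) 0.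
have f_ge0 u x : 0 <= f u x by rewrite le_max lexx orbT.
have msq u : measurable_fun [set: 'rV[R]_n] (fun x => inner u x ^+ 2).
  by apply: measurable_funX; exact: measurable_inner.
have mf u : measurable_fun [set: 'rV[R]_n] (f u).
  apply: (measurable_maxr (g := cst 0)) => //.
  exact: measurable_funB.
have mB := @measurable_lp_ball R n p.
have a_le1 x : lp_ball n p x -> `|inner a x| <= 1.
  by rewrite inner_delta; exact: lp_ball_coord_le1.
have fa0 x : lp_ball n p x -> f a x = 0.
  by move=> xB; apply/max_idPr; rewrite subr_le0 -real_normK ?num_real// exprn_ile1 ?a_le1//.
have b_le x : lp_ball n p x -> `|inner b x| <= 2 `^ (q^-1 - 2^-1).
  move=> xB; rewrite bE inner_two_spike -s_normE qV normrM gtr0_norm//.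
  rewrite ler_pM2l// (le_trans (ler_normD _ _))//.
  exact: lp_ball_two_coords.
(* The box above the point with two entries [s]: there [inner b x > 2 * s ^+ 2]. *)
have Efb : (0 < 'E_P[fun w => f b (X w)])%E.
  have ltT : \sum_(k < n) two_spike i j s 0 k `^ p < 1.
    rewrite (sum_two_spike (F := fun t => t `^ p) _ ij) ?powR0 ?gt_eqF//.
    suff : s `^ p < 2^-1 by lra.
    (* here [p > 2] enters: [s `^ p = 2 `^ (- p / 2)] *)
    rewrite sE -powRrM -[ltRHS](powR_inv1 (ler0n _ 2)); apply: gt1_ltr_powR.
      by rewrite ltr1n.
    lra.
  have ts_ge0 k : 0 <= two_spike i j s 0 k.
    by rewrite !mxE mulr_ge0 ?(ltW s_gt0)// addr_ge0 ?ler0n.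
  have [A [mA AB A_gt0 sA]] := lp_ball_upper_box p_gt0 ts_ge0 ltT.
  apply: (@expectation_gt0 _ _ _ _ _ (X @^-1` A)).
  - exact: measurableT_comp (mf b) (measurable_funPT X).
  - by move=> w; exact: f_ge0.
  - by rewrite -[X in measurable X]setTI; exact: measurable_funPT.
  - exact: uniform_on_gt0 hX _ _ _ _.
  - move=> w /= Aw; rewrite lt_max subr_gt0; apply/orP; left.
    have := sA _ i Aw; have := sA _ j Aw.
    rewrite !mxE !eqxx (negbTE ij) eq_sym (negbTE ij) /= => sj si.
    have {}si : s < X w 0 i by rewrite addr0 mulr1 in si.
    have {}sj : s < X w 0 j by rewrite add0r mulr1 in sj.
    rewrite bE inner_two_spike.
    have : 1 < s * (X w 0 i + X w 0 j); last by nra.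
    have -> : 1 = s * (s + s) :> R by rewrite -mulr2n mulrnAr -expr2 s2; lra.
    by rewrite ltr_pM2l// ltrD.
have Efa : ('E_P[fun w => f a (X w)] = 0)%E by exact: uniform_on_expectation0 hX _ _ _.
have sum_a2 : \sum_(k < n) (\row_l (a 0 l ^+ 2)) 0 k = 1.
  rewrite (bigD1 i)//= big1 => [|k ki]; first by rewrite !mxE !eqxx expr1n addr0.
  by rewrite !mxE (negbTE ki) expr0n.
have sum_b2 : \sum_(k < n) (\row_l (b 0 l ^+ 2)) 0 k = 1.
  under eq_bigr do rewrite mxE.
  by rewrite bE (sum_two_spike (F := fun t => t ^+ 2) s ij) ?expr0n// s2; lra.
have int_sq u M : (forall x, lp_ball n p x -> `|inner u x| <= M) ->
    P.-integrable setT (fun w => (inner u (X w) ^+ 2)%:E).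
  move=> uM; apply: (uniform_on_integrable mB hX (M := M ^+ 2) (msq u)) => x xB.
  by rewrite normrX lerXn2r ?nnegrE ?uM// (le_trans _ (uM x xB)).
have int_f u : P.-integrable setT (fun w => (inner u (X w) ^+ 2)%:E) ->
    P.-integrable setT (fun w => (f u (X w))%:E).
  apply: le_integrable => //.
    by apply/measurable_EFinP; exact: measurableT_comp (mf u) (measurable_funPT X).
  move=> w _; rewrite lee_fin ger0_norm ?f_ge0// ger0_norm ?sqr_ge0//.
  by rewrite ge_max sqr_ge0 andbT gerBl.
split; [|split; [|split; [|split; [|split; [|split; [|split; [|split]]]]]]] => //.
- rewrite -ltf_pV2 ?posrE// qV; lra.
- apply: (majorizes_concentrated (i := i)).
  + by move=> k; rewrite mxE sqr_ge0.
  + by move=> k; rewrite mxE sqr_ge0.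
  + by rewrite sum_a2 sum_b2.
  + by rewrite sum_b2 !mxE !eqxx expr1n.
- exact: sup_inner_delta.
- rewrite bE sup_inner_two_spike ?(ltW s_gt0)// lq_norm_two_spike ?(ltW s_gt0)//.
  by rewrite -qV.
- exact: int_sq a_le1.
- exact: int_sq b_le.
- move=> /(_ _ (@convex_pos_part_sub1 R)) Eb_le_Ea.
  have := Eb_le_Ea (int_f _ (int_sq _ _ b_le)) (int_f _ (int_sq _ _ a_le1)).
  by rewrite leNgt Efa Efb.
Qed.
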